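(* Let $g:\mathbb{N}\to\mathbb{N}$ be a function such that for every $k\in\mathbb{N}$, every digraph $D$ with $\delta^+(D)\geq g(k)$ contains $k$ vertex-disjoint directed cycles of pairwise distinct lengths. Then for every $k\in\mathbb{N}$, every digraph $D$ with $\delta^+(D)\geq g(k)$, and every strictly positive vertex-weighting $w:V(D)\to\mathbb{R}_+$, there exist $k$ vertex-disjoint directed cycles in $D$ with pairwise distinct total weights according to $w$.
   Context: $\mathbb{N}=\{1,2,3,\ldots\}$ and $\mathbb{R}_+$ is the set of strictly positive real numbers. All digraphs are finite, non-empty and simple (no loops, no parallel edges in the same direction), but anti-parallel pairs of edges are allowed. $\delta^+(D)=\min_{v\in V(D)} d_D^+(v)$ denotes the minimum out-degree. The length of a directed cycle is its number of edges; directed cycles of length $2$ are allowed. The total weight of a directed cycle $C$ according to $w$ is $\sum_{v\in V(C)}w(v)$. A function $g$ with the property assumed in the claim exists (this is a theorem, known as Lichiardopol's conjecture). *)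

(* Defs.v *)
From mathcomp Require Import all_boot all_order all_algebra.
From mathcomp Require Import reals.

Set Implicit Arguments.
Unset Strict Implicit.
Unset Printing Implicit Defensive.

Record digraph := Digraph {
  vertex :> finType;
  edge : rel vertex;
  edge_irrefl : irreflexive edge;
  vertex_gt0 : 0 < #|vertex|
}.

Definition outdeg (D : digraph) (u : D) : nat := #|[set v | edge u v]|.

(* The initial value #|D| exceeds every out-degree and D is non-empty, so it
   never affects the minimum: see min_outdeg_le and min_outdeg_attained. *)
Definition min_outdeg (D : digraph) : nat :=
  \big[minn/#|D|]_(u : D) outdeg u.

Lemma min_outdeg_le (D : digraph) (u : D) : min_outdeg D <= outdeg u.
Proof.
rewrite /min_outdeg; have := mem_index_enum u.
elim: (index_enum D) => // v s IH; rewrite inE big_cons geq_min.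
by case/predU1P => [<-|/IH ->]; rewrite ?leqnn ?orbT.
Qed.

Lemma min_outdeg_attained (D : digraph) :
  exists u : D, min_outdeg D = outdeg u.
Proof.
have /card_gt0P[u0 _] := vertex_gt0 D.
have : min_outdeg D = #|D| \/ exists u : D, min_outdeg D = outdeg u.
  rewrite /min_outdeg; elim/big_rec: _ => [|u m _ IH]; first by left.
  by rewrite /minn; case: ifP => _; [right; exists u | exact: IH].
case=> // eD; exists u0; apply/eqP.
by rewrite eqn_leq min_outdeg_le eD max_card.
Qed.

(* A directed cycle is given by the list of its vertices in cyclic order from
   some starting point; [size c] is then its number of edges. A one-vertex list
   is excluded by irreflexivity, while length 2 is allowed. *)
Definition dicycle (D : digraph) (c : seq D) : Prop :=
  c <> [::] /\ ucycle (@edge D) c.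

Definition cycle_weight (R : realType) (D : digraph) (w : D -> R)
    (c : seq D) : R :=
  (\sum_(v <- c) w v)%R.

(* The quantity f that must be pairwise distinct is the length or the weight;
   both are independent of the starting points of the cycles. *)
Definition disjoint_dicycles_distinct (D : digraph) (k : nat) (T : Type)
    (f : seq D -> T) : Prop :=
  exists C : 'I_k -> seq D,
    [/\ forall i, dicycle (C i),
        forall i j, i != j -> [disjoint C i & C j]
      & forall i j, i != j -> f (C i) <> f (C j)].

Arguments disjoint_dicycles_distinct D k {T} f.

(* Main.v *)
(** By simultaneous Diophantine approximation there are positive integer
    weights [m] such that two cycles with the same [w]-weight also have the same
    [m]-weight, so it suffices to separate [m]-weights. Replace every vertex [v]
    by [m v] successive layers of [d] vertices each, consecutive layers being
    completely joined, where all edges entering [v] go to a single vertex of the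
    first layer. Minimum out-degree at least [d] is preserved, and every cycle
    that meets the layers of [v] passes through that single entry and crosses
    all [m v] layers. Hence disjoint cycles of the new digraph project to
    disjoint cycles of the original one, and length becomes [m]-weight. *)
Require Import Defs.
From mathcomp Require Import all_boot all_order all_algebra.
From mathcomp Require Import reals.
From mathcomp Require Import zify lra.

Set Implicit Arguments.
Unset Strict Implicit.
Unset Printing Implicit Defensive.

Import Order.TTheory GRing.Theory Num.Theory.

Section IntegerWeights.
Local Open Scope ring_scope.

(** Dirichlet's pigeonhole: among [K.+1] multiples of [w], two have all their fractional parts in
    the same box of side [Q^-1]; the difference of their indices serves as [N]. *)
Lemma simultaneous_approximation (R : realType) (T : finType) (w : T -> R)
    (Q : nat) :
  (0 < Q)%N ->
  exists2 N : nat, (0 < N)%N & exists m : T -> int,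
    forall v, `|N%:R * w v - (m v)%:~R| < Q%:R^-1.
Proof.
case: Q => // q _; set Q := q.+1.
have Q_gt0 : 0 < Q%:R :> R by rewrite ltr0n.
pose fl i v : int := Num.floor (i%:R * w v).
pose fr i v : R := i%:R * w v - (fl i v)%:~R.
have fr_ge0 i v : 0 <= fr i v by rewrite subr_ge0 floor_le.
have fr_lt1 i v : fr i v < 1.
  by have := floorD1_gt (i%:R * w v); rewrite /fr intrD; lra.
pose K := #|{ffun T -> 'I_Q}|.
pose box (i : 'I_K.+1) : {ffun T -> 'I_Q} :=
  [ffun v => inord (Num.truncn (Q%:R * fr i v))].
have /injectivePn[i [j neq_ij eq_box]] : ~~ injectiveb box.
  apply/negP => /injectiveP /leq_card.
  by rewrite card_ord ltnn.
have close (a b : 'I_K.+1) v : box a = box b -> fr a v - fr b v < Q%:R^-1.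
  move=> /ffunP/(_ v); rewrite !ffunE => /(congr1 (@nat_of_ord _)).
  have lt_Q c : (Num.truncn (Q%:R * fr c v) < Q)%N.
    rewrite -(ltr_nat R); apply: le_lt_trans (_ : Q%:R * fr c v < _).
      by rewrite truncn_le mulr_ge0 // ltW.
    by rewrite -[ltRHS]mulr1 ltr_pM2l.
  rewrite !inordK // => eq_t.
  rewrite -[ltRHS]mul1r ltr_pdivlMr // mulrC mulrBr.
  have /andP[_ lt_a] := truncn_itv (mulr_ge0 (ltW Q_gt0) (fr_ge0 a v)).
  have /andP[le_b _] := truncn_itv (mulr_ge0 (ltW Q_gt0) (fr_ge0 b v)).
  move: lt_a; rewrite eq_t -natr1 => lt_a; lra.
wlog lt_ij : i j neq_ij eq_box / (j < i)%N.
  move=> wl; case: (ltngtP i j) => [lt_ij|lt_ij|/val_inj eq_ij].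
  - by apply: (wl j i) => //; rewrite eq_sym.
  - exact: (wl i j).
  - by rewrite eq_ij eqxx in neq_ij.
exists (i - j)%N; first by rewrite subn_gt0.
exists (fun v => fl i v - fl j v) => v.
have -> : (i - j)%:R * w v - (fl i v - fl j v)%:~R = fr i v - fr j v.
  by rewrite natrB ?(ltnW lt_ij) // intrB mulrBl /fr; lra.
by rewrite ltr_norml close // ltrNl opprB close.
Qed.

Lemma integer_weights (R : realType) (T : finType) (w : T -> R) :
  (forall v, 0 < w v) ->
  exists2 m : T -> nat, (forall v, (0 < m v)%N) &
    forall c c' : seq T, uniq c -> uniq c' ->
      \sum_(v <- c) w v = \sum_(v <- c') w v ->
      (\sum_(v <- c) m v = \sum_(v <- c') m v)%N.
Proof.
move=> w_gt0.
(* The first summand gives [Q^-1 <= w v], which forces [m v] to be positive. The second gives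
   [#|T| / Q < 1/2], so two integers this close to the same real coincide. *)
pose Q := (\max_v (Num.truncn (w v)^-1).+1 + (#|T|.*2).+1)%N.
have Q_gt0 : (0 < Q)%N by rewrite /Q addnS.
have Q_gt0R : 0 < Q%:R :> R by rewrite ltr0n.
have Qw v : Q%:R^-1 <= w v.
  rewrite -[leRHS]invrK lef_pV2 ?posrE ?invr_gt0 //.
  apply: ltW; apply: lt_le_trans (truncnS_gt _) _; rewrite ler_nat.
  apply: leq_trans (leq_addr _ _).
  exact: (leq_bigmax (F := fun v => (Num.truncn (w v)^-1).+1)).
have QT : (#|T|.*2)%:R < Q%:R :> R by rewrite ltr_nat /Q addnS ltnS leq_addl.
have [N N_gt0 [m mP]] := simultaneous_approximation w Q_gt0.
have m_gt0 v : 0 < m v.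
  rewrite -(ltr0z R); have := mP v; rewrite ltr_norml => /andP[_].
  have : w v <= N%:R * w v by rewrite ler_peMl ?(ltW (w_gt0 v)) // ler1n.
  by have := Qw v; lra.
have mE v : (m v)%:~R = `|m v|%N%:R :> R.
  by rewrite -[in LHS](gtz0_abs (m_gt0 v)).
exists (fun v => `|m v|%N) => [v|c c' Uc Uc' eq_w].
  by rewrite absz_gt0 gt_eqF.
(* A duplicate-free [s] has at most [#|T|] terms, each with an error below [Q^-1]. *)
have near s : uniq s ->
    `|N%:R * \sum_(v <- s) w v - (\sum_(v <- s) `|m v|)%N%:R| <= #|T|%:R / Q%:R.
  move=> Us; rewrite natr_sum mulr_sumr -sumrB.
  apply: le_trans (ler_norm_sum _ _ _) _.
  apply: le_trans (_ : \sum_(v <- s) Q%:R^-1 <= _).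
    by apply: ler_sum => v _; rewrite -mE ltW.
  rewrite big_const_seq count_predT iter_addr_0 -[leLHS]mulr_natl.
  by rewrite ler_pM2r ?invr_gt0 // ler_nat -(card_uniqP Us) max_card.
have half : #|T|%:R / Q%:R < 2^-1 :> R.
  rewrite ltr_pdivrMr //; move: QT; rewrite -mul2n natrM; lra.
move: (near c Uc) (near c' Uc') half; rewrite eq_w !ler_norml.
set a := (\sum_(v <- c) _)%N; set b := (\sum_(v <- c') `|m v|)%N.
move=> /andP[a1 a2] /andP[b1 b2] half.
apply/eqP; rewrite eqn_leq.
by apply/andP; split; rewrite -ltnS -(ltr_nat R) -natr1; lra.
Qed.

End IntegerWeights.

Section Layers.
Variables (D : digraph) (m : D -> nat) (M d : nat).
Hypotheses (m_gt0 : forall v, 0 < m v) (m_le : forall v, m v <= M).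

(* The vertex [(v, j, a)] is the [a]-th vertex of the [j]-th layer of [v]. Those
   with [m v <= j], and the [(v, 0, a)] with [a != 0], have no in-edges, so no
   cycle sees them: keeping them makes the vertex type a plain product. *)
Notation layered_vertex := (D * 'I_M.+1 * 'I_d.+1)%type.
Implicit Types (x y : layered_vertex) (p : seq layered_vertex).

Definition entry (v : D) : layered_vertex := (v, ord0, ord0).
Definition is_entry x := x == entry x.1.1.

Definition layer_step x y :=
  [&& y.1.1 == x.1.1, y.1.2 == x.1.2.+1 :> nat & y.1.2 < m x.1.1].
(** With [<=] instead of equality, vertices beyond the last layer also get out-edges and do not
    lower the minimum out-degree. *)
Definition exit_step x y :=
  [&& is_entry y, m x.1.1 <= x.1.2.+1 & edge x.1.1 y.1.1].
Definition layered_edge x y := layer_step x y || exit_step x y.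

Lemma layered_edge_irrefl : irreflexive layered_edge.
Proof.
by move=> x; rewrite /layered_edge /layer_step /exit_step edge_irrefl; lia.
Qed.

Lemma layered_vertex_gt0 : 0 < #|{: layered_vertex}|.
Proof. by have /card_gt0P[v _] := vertex_gt0 D; apply/card_gt0P; exists (entry v). Qed.

Definition layered := Digraph layered_edge_irrefl layered_vertex_gt0.

(** Before the last layer of [v], a vertex sees the [d.+1] vertices of the next layer; any other
    sees the entries of all out-neighbours of [v]. *)
Lemma min_outdeg_layered : d < min_outdeg D -> d < min_outdeg layered.
Proof.
move=> dD; have [[[v j] a] ->] := min_outdeg_attained layered.
have [le_mj|lt_jm] := leqP (m v) j.+1.
  apply: leq_trans (leq_trans dD (min_outdeg_le v)) _.
  rewrite /outdeg -(card_imset (f := entry)); last by move=> ? ? [].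
  apply/subset_leq_card/subsetP => _ /imsetP[u + ->]; rewrite !inE => vu.
  by rewrite /= /layered_edge /exit_step /is_entry /= eqxx le_mj vu orbT.
have lt_jM : j.+1 < M.+1 by rewrite ltnS (leq_trans (ltnW lt_jm)).
pose up (b : 'I_d.+1) : layered_vertex := (v, Ordinal lt_jM, b).
rewrite -{1}[d.+1]card_ord -cardsT -(card_imset (f := up)); last by move=> ? ? [].
apply/subset_leq_card/subsetP => _ /imsetP[b _ ->]; rewrite inE.
by rewrite /= /layered_edge /layer_step /= !eqxx lt_jm.
Qed.

Definition entries p : seq D := [seq x.1.1 | x <- p & is_entry x].

Lemma mem_entries p v : (v \in entries p) = (entry v \in p).
Proof.
apply/mapP/idP => [[x]|vp].
  by rewrite mem_filter => /andP[/eqP xE xp] ->; rewrite -xE.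
by exists (entry v); rewrite // mem_filter vp /is_entry eqxx.
Qed.

Lemma uniq_entries p : uniq p -> uniq (entries p).
Proof.
move=> Up; rewrite map_inj_in_uniq ?filter_uniq // => x y.
rewrite !mem_filter => /andP[/eqP xE _] /andP[/eqP yE _] eq_xy.
by rewrite xE yE eq_xy.
Qed.

(** The layer index grows by one until an exit, possible only from the last layer, resets it to 0.
    The term [x.1.2] accounts for the layers of [x.1.1] already behind the start. *)
Lemma layered_path x p u : x.1.2 < m x.1.1 ->
  path layered_edge x (rcons p (entry u)) ->
  path (@edge D) x.1.1 (rcons (entries p) u) /\
  x.1.2 + (size p).+1 = m x.1.1 + \sum_(v <- entries p) m v.
Proof.
elim: p x => [|y p IH] x lt_xm /=.
  rewrite /layered_edge /layer_step /exit_step andbT big_nil /= andbF /=.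
  by case/and3P => _ le_m ->; split => //; lia.
case/andP => /orP[/and3P[/eqP yx /eqP yj lt_ym]|/and3P[y_in le_mx xy]] yp.
  have /negbTE yN : ~~ is_entry y.
    by apply/negP => /eqP yE; move: yj; rewrite yE.
  rewrite /entries /= yN -/(entries p) -yx.
  have [|-> eq_sz] := IH y _ yp; first by rewrite yx.
  by split => //; rewrite -eq_sz yj; lia.
have y0 : y.1.2 = 0 :> nat by rewrite (eqP y_in).
rewrite /entries /= y_in -/(entries p) /= big_cons xy.
have [|-> eq_sz] := IH y _ yp; first by rewrite y0.
by split => //; rewrite -eq_sz y0; lia.
Qed.

(** Without entries only layer steps remain, and the layer index cannot strictly increase all the
    way around a cycle. *)
Lemma layered_cycle_entry p : p <> [::] -> cycle layered_edge p ->
  exists v, entry v \in p.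
Proof.
case: p => // x p _ /= x_cycle.
have [/hasP[y yp /eqP yE]|/hasPn no_entry] := boolP (has is_entry (x :: p)).
  by exists y.1.1; rewrite -yE.
pose lt_layer : rel layered_vertex := fun y z => y.1.2 < z.1.2.
have : path lt_layer x (rcons p x).
  apply: (sub_in_path (P := [in x :: p])) x_cycle => [y z _ zp|].
    rewrite /layered_edge /exit_step (negbTE (no_entry z zp)) orbF.
    by case/and3P => _ /eqP zj _; rewrite /lt_layer zj.
  by rewrite /= mem_head all_rcons mem_head; apply/allP => y; rewrite inE orbC => ->.
move/(order_path_min (fun _ _ _ => @ltn_trans _ _ _)).
by rewrite all_rcons /lt_layer ltnn.
Qed.

Lemma layered_dicycle (c : seq layered) : dicycle c ->
  exists c' : seq D, [/\ dicycle c', size c = \sum_(v <- c') m v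
    & forall v, v \in c' -> entry v \in c].
Proof.
case=> c0 uc; have [v vc] := layered_cycle_entry c0 (ucycle_cycle uc).
(* Rotated to start at [entry v], the cycle is a path from layer index 0 back to the same entry, as
   [layered_path] requires. *)
have [i p rot_c] := rot_to vc.
exists (entries (entry v :: p)); split.
- split; first by rewrite /entries /= /is_entry eqxx.
  have := uc; rewrite -(rot_ucycle i) rot_c => /andP[vp Up].
  rewrite /ucycle uniq_entries // andbT.
  have [] := @layered_path (entry v) p v (m_gt0 v) vp.
  by rewrite /entries /= /is_entry eqxx.
- have := uc; rewrite -(rot_ucycle i) -(size_rot i) rot_c => /andP[vp _].
  have [_] := @layered_path (entry v) p v (m_gt0 v) vp.
  by rewrite /entries /= /is_entry eqxx /= big_cons.
- by move=> u; rewrite mem_entries -rot_c mem_rot.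
Qed.

Lemma layered_dicycles_distinct k :
  disjoint_dicycles_distinct layered k size ->
  disjoint_dicycles_distinct D k (fun c => \sum_(v <- c) m v).
Proof.
case=> C [cycC disC neqC].
have /fin_all_exists[C' C'P] i := layered_dicycle (cycC i).
exists C'; split => [i|i j neq_ij|i j neq_ij].
- by have [] := C'P i.
- have [_ _ C'i] := C'P i; have [_ _ C'j] := C'P j.
  apply/pred0P => v /=; apply/negP => /andP[/C'i vi /C'j vj].
  (* A vertex on both projections would put its entry on both layered cycles. *)
  by have /pred0P/(_ (entry v)) := disC i j neq_ij; rewrite /= vi vj.
- have [_ <- _] := C'P i; have [_ <- _] := C'P j; exact: neqC.
Qed.

End Layers.

Theorem corollary3 (R : realType) (g : nat -> nat)
    (g_gt0 : forall k : nat, 0 < k -> 0 < g k)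
    (hg : forall k : nat, 0 < k ->
      forall D : digraph, g k <= min_outdeg D ->
        disjoint_dicycles_distinct D k (fun c : seq D => size c)) :
  forall k : nat, 0 < k ->
    forall D : digraph, g k <= min_outdeg D ->
      forall w : D -> R, (forall v : D, (0 < w v)%R) ->
        disjoint_dicycles_distinct D k (cycle_weight w).
Proof.
move=> k k_gt0 D gD w w_gt0.
have [m m_gt0 mP] := integer_weights w_gt0.
have m_le v : m v <= \max_u m u by exact: leq_bigmax.
(* Layers have [d.+1] vertices, so [d] is taken to be [(g k).-1]. *)
have gE : (g k).-1.+1 = g k by rewrite prednK ?g_gt0.
have := @min_outdeg_layered D m _ (g k).-1 m_le; rewrite gE => /(_ gD).
case/(hg k k_gt0)/(layered_dicycles_distinct m_gt0) => C [cycC disC neqC].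
exists C; split => // i j neq_ij eq_w; apply: (neqC i j neq_ij).
have uniqC l : uniq (C l) by have [_ /andP[]] := cycC l.
exact: mP.
Qed.
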